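(* Let $(V,\mathcal Y(z),c,\rho)$ be a graded vertex operator coalgebra with $\dim C(V)<\infty$, and let $(\mathcal M^1,\mathcal Y_{\mathcal M^1}(z))$ and $(\mathcal M^2,\mathcal Y_{\mathcal M^2}(z))$ be two admissible $V$-comodules. If $\psi:\mathcal M^1\to\mathcal M^2$ is a $V$-comodule homomorphism, then $\psi|_{M^1_0}:M^1_0\to M^2_0$ is a $C(V)$-comodule homomorphism. Thus $\Omega(\mathcal M)=M_0$ (with $\Omega(\psi)=\psi|_{M^1_0}$) defines a functor $\Omega$ from the category of admissible $V$-comodules to the category of $C(V)$-comodules.
   Context: Conventions: all vector spaces are over $\mathbb C$; $\otimes=\otimes_{\mathbb C}$; $W^*=\mathrm{Hom}(W,\mathbb C)$ and $(\cdot,\cdot)$ is the natural pairing; $\tau(v\otimes w)=w\otimes v$; $V\otimes\mathbb C=\mathbb C\otimes V=V$; $\mathrm{Res}_z$ is the coefficient of $z^{-1}$; $(z_1+z_2)^n=\sum_{i\ge0}\binom{n}{i}z_1^{n-i}z_2^i$; $\delta(x)=\sum_{n\in\mathbb Z}x^n$. Vertex coalgebra: a triple $(V,\mathcal Y(z),c)$ with $V$ a vector space and linear maps $c:V\to\mathbb C$, $\mathcal Y(z):V\to V\otimes V[[z,z^{-1}]]$, $\mathcal Y(z)v=\sum_{k\in\mathbb Z}\Delta_k(v)z^{-k-1}$, such that for all $v\in V$: (i) each $\Delta_k(v)$ is a finite sum (an element of $V\otimes V$) and $\Delta_k(v)=0$ for $k\ll0$; (ii) $(c\otimes\mathrm{Id}_V)\mathcal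 Y(z)v=v$, $(\mathrm{Id}_V\otimes c)\mathcal Y(z)v\in V[[z]]$ and $\lim_{z\to0}(\mathrm{Id}_V\otimes c)\mathcal Y(z)v=v$; (iii) (Jacobi identity) on $V$, $z_0^{-1}\delta(\frac{z_1-z_2}{z_0})(\mathrm{Id}_V\otimes \mathcal Y(z_2))\mathcal Y(z_1)-z_0^{-1}\delta(\frac{z_2-z_1}{-z_0})(\tau\otimes\mathrm{Id}_V)(\mathrm{Id}_V\otimes \mathcal Y(z_1))\mathcal Y(z_2)=z_1^{-1}\delta(\frac{z_2+z_0}{z_1})(\mathcal Y(z_0)\otimes\mathrm{Id}_V)\mathcal Y(z_2)$. It is graded if $V=\oplus_{s\in\mathbb Z}V_s$ with $\dim V_s<\infty$, $V_s=0$ for $s\ll0$, and $\Delta_k(V_s)\subseteq (V\otimes V)_{s+k+1}$, where $(V\otimes V)_t=\oplus_s V_{t-s}\otimes V_s$. Graded vertex operator coalgebra $(V,\mathcal Y(z),c,\rho)$: a graded vertex coalgebra with a linear map $\rho:V\to\mathbb C$ such that, writing $(\rho\otimes\mathrm{Id}_V)\mathcal Y(z)=\sum_{k\in\mathbb Z}L(k)z^{k-2}$, one has $L(k)\in\mathrm{End}(V)$, $[L(k),L(j)]=(k-j)L(k+j)+\frac{k^3-k}{12}\delta_{k+j,0}d$ for some $d\in\mathbb C$, $V_s$ is the eigenspace of $L(0)$ with eigenvalue $s$, and $(L(1)\otimes\mathrm{Id}_V)\mathcal Y(z)=\frac{d}{dz}\mathcal Y(z)$. Convention for $L(0)$-powers: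 $z^{L(0)}$ and $(1+z)^{L(0)}$ act on $V_s$ as $z^s$ and $(1+z)^s=\sum_{i\ge0}\binom{s}{i}z^i$. Possibly infinite sums in expressions $\mathrm{Res}_z(\varphi(z)^{L(0)}\cdots\otimes\mathrm{Id})\mathcal Y(z)v$ (or with $\mathcal Y_{\mathcal M}$) are read componentwise in the bihomogeneous components. Weak $V$-comodule: a vector space $\mathcal M$ with a linear map $\mathcal Y_{\mathcal M}(z)=\sum_{k\in\mathbb Z}\Delta_{\mathcal M,k}z^{-k-1}:\mathcal M\to V\otimes\mathcal M[[z,z^{-1}]]$ such that (i) $\Delta_{\mathcal M,k}(m)$ is a finite sum and vanishes for $k\ll0$; (ii) $(c\otimes\mathrm{Id}_{\mathcal M})\mathcal Y_{\mathcal M}(z)m=m$; (iii) $z_0^{-1}\delta(\frac{z_1-z_2}{z_0})(\mathrm{Id}_V\otimes \mathcal Y_{\mathcal M}(z_2))\mathcal Y_{\mathcal M}(z_1)-z_0^{-1}\delta(\frac{z_2-z_1}{-z_0})(\tau\otimes\mathrm{Id}_{\mathcal M})(\mathrm{Id}_V\otimes \mathcal Y_{\mathcal M}(z_1))\mathcal Y_{\mathcal M}(z_2)=z_1^{-1}\delta(\frac{z_2+z_0}{z_1})(\mathcal Y(z_0)\otimes\mathrm{Id}_{\mathcal M})\mathcal Y_{\mathcal M}(z_2)$; (iv) writing $(\rho\otimes\mathrm{Id}_{\mathcal M})\mathcal Y_{\mathcal M}(z)=\sum_kL(k)z^{k-2}$, the $L(k)\in\mathrm{End}(\mathcal M)$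 satisfy the Virasoro relations above; (v) $(L(1)\otimes\mathrm{Id}_{\mathcal M})\mathcal Y_{\mathcal M}(z)=\frac{d}{dz}\mathcal Y_{\mathcal M}(z)=\mathcal Y_{\mathcal M}(z)L(1)-(\mathrm{Id}_V\otimes L(1))\mathcal Y_{\mathcal M}(z)$. It is admissible if $\mathcal M=\oplus_{t\in\mathbb N}M_t$ with $\Delta_{\mathcal M,k}(M_t)\subseteq\oplus_{s\in\mathbb N}V_{t+k+1-s}\otimes M_s$. A $V$-comodule homomorphism $\psi:\mathcal M^1\to\mathcal M^2$ is a linear map with $(\mathrm{Id}\otimes\psi)\mathcal Y_{\mathcal M^1}(z)=\mathcal Y_{\mathcal M^2}(z)\psi$. $C(V)=\mathrm{Span}\{v\in V\mid \mathrm{Res}_z(\frac{(1+z)^{L(0)}}{z^2}\otimes \mathrm{Id}_V)\mathcal Y(z)v=0\}$; when $\dim C(V)<\infty$ it is a coassociative coalgebra with $\Delta(v)=\mathrm{Res}_z(\frac{(1+z)^{L(0)}}{z}\otimes \mathrm{Id}_V)\mathcal Y(z)v$ and counit $c|_{C(V)}$. For an admissible $V$-comodule $\mathcal M$, $M_0$ is a left $C(V)$-comodule via $\Delta_{M_0}(m)=\mathrm{Res}_z(z^{L(0)-1}\otimes\mathrm{Id}_{\mathcal M})\mathcal Y_{\mathcal M}(z)m$.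
   Formalization: Homomorphisms of admissible comodules are required to map M^1_0 into M^2_0, which is not automatic (shift the grading by one); that C(V) is a coalgebra and M_0 a C(V)-comodule via the given formulas is assumed, as recalled earlier results. *)

(* Defs.v *)
From HB Require Import structures.
From mathcomp Require Import all_boot all_order all_algebra.
From mathcomp Require Import generic_quotient ring_quotient freeg.
From mathcomp Require Import boolp classical_sets cardinality fsbigop reals.
From mathcomp Require Import finmap.
From mathcomp Require Import complex.

Set Implicit Arguments.
Unset Strict Implicit.
Unset Printing Implicit Defensive.

Import Order.TTheory GRing.Theory Num.Theory.

Local Open Scope classical_set_scope.
Local Open Scope ring_scope.

(* Everything is developed over an arbitrary field K; the theorem is stated
   for K = R[i] with R : realType, i.e. over the complex numbers.
   Vector spaces are arbitrary (possibly infinite dimensional) lmodTypes. *)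

Record subspace (K : fieldType) (W : lmodType K) := Subspace {
  subspace_pred :> {pred W};
  subspace_closed : submod_closed subspace_pred }.

HB.instance Definition _ (K : fieldType) (W : lmodType K) (U : subspace W) :=
  GRing.isSubmodClosed.Build K W (subspace_pred U) (subspace_closed U).

Definition subspace_sort (K : fieldType) (W : lmodType K) (U : subspace W) :=
  {w : W | w \in U}.

Section SubspaceType.
Context {K : fieldType} {W : lmodType K} (U : subspace W).

HB.instance Definition _ :=
  [isSub of subspace_sort U for @sval W (fun w => w \in U)].
HB.instance Definition _ := [Choice of subspace_sort U by <:].
HB.instance Definition _ := [SubChoice_isSubZmodule of subspace_sort U by <:].
HB.instance Definition _ := [SubZmodule_isSubLmodule of subspace_sort U by <:].

Definition incl : {linear subspace_sort U -> W} := val.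

End SubspaceType.

Section Span.
Context {K : fieldType} {W : lmodType K}.
Implicit Types (S : set W) (U : subspace W).

Definition span_pred S : {pred W} :=
  [pred w | `[< forall U, (forall s, S s -> s \in U) -> w \in U >]].

Lemma span_predP S w :
  w \in span_pred S <-> forall U, (forall s, S s -> s \in U) -> w \in U.
Proof. by split=> [/asboolP //|h]; apply/asboolP. Qed.

Lemma span_closed S : submod_closed (span_pred S).
Proof.
split=> [|a u v]; first by apply/span_predP => U _; exact: rpred0.
move=> /span_predP hu /span_predP hv; apply/span_predP => U hU.
by rewrite rpredD ?rpredZ ?hu ?hv.
Qed.

Definition lspan S : subspace W := Subspace (span_closed S).

Definition fin_dim U : Prop :=
  exists (n : nat) (e : 'I_n -> W), {subset U <= lspan (range e)}.

End Span.

Section SubRestrict.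
Context {K : fieldType} {W W' : lmodType K}.
Variables (U : subspace W) (U' : subspace W') (f : {linear W -> W'}).
Hypothesis fUU' : forall u, u \in U -> f u \in U'.

Definition restrict_fun (u : subspace_sort U) : subspace_sort U' :=
  exist _ (f (val u)) (fUU' (valP u)).

Lemma restrict_linear : linear restrict_fun.
Proof. by move=> a u v; apply: val_inj; rewrite /= !linearP. Qed.

HB.instance Definition _ :=
  GRing.isLinear.Build K (subspace_sort U) (subspace_sort U') *:%R
    restrict_fun restrict_linear.

Definition restrict : {linear subspace_sort U -> subspace_sort U'} :=
  restrict_fun.

End SubRestrict.

Section QuotientSpace.
Context {K : fieldType} {W : lmodType K} (U : subspace W).
Local Open Scope quotient_scope.

Definition quotient_space := Quotient.quot (subspace_pred U).
HB.instance Definition _ := GRing.Zmodule.on quotient_space.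

Definition qproj (w : W) : quotient_space :=
  \pi_(Quotient.quot (subspace_pred U)) w.
Definition qrepr (x : quotient_space) : W :=
  repr (x : Quotient.quot (subspace_pred U)).
Definition qscale (a : K) (x : quotient_space) : quotient_space :=
  qproj (a *: qrepr x).

Lemma qreprK x : qproj (qrepr x) = x. Proof. exact: reprK. Qed.

Lemma qprojP u v : (qproj u = qproj v) <-> (u - v \in U).
Proof.
rewrite /qproj; split=> [/eqP|h]; first by rewrite -Quotient.idealrBE.
by apply/eqP; rewrite -Quotient.idealrBE.
Qed.

Lemma qprojD u v : qproj (u + v) = qproj u + qproj v.
Proof. by rewrite /qproj Quotient.pi_add. Qed.

Lemma qprojZ a u : qproj (a *: u) = qscale a (qproj u).
Proof.
apply/qprojP; rewrite -scalerBr; apply: rpredZ; apply/qprojP.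
by rewrite qreprK.
Qed.

Lemma qscaleA a b x : qscale a (qscale b x) = qscale (a * b) x.
Proof. by rewrite -[x]qreprK -!qprojZ scalerA. Qed.
Lemma qscale1 : left_id 1 qscale.
Proof. by move=> x; rewrite -[x]qreprK -!qprojZ scale1r. Qed.
Lemma qscaleDr : right_distributive qscale +%R.
Proof.
move=> a x y; rewrite -[x]qreprK -[y]qreprK.
by rewrite -qprojD -!qprojZ -qprojD scalerDr.
Qed.
Lemma qscaleDl x : {morph qscale^~ x : a b / a + b}.
Proof. by move=> a b; rewrite -[x]qreprK -!qprojZ -qprojD scalerDl. Qed.

HB.instance Definition _ := GRing.Zmodule_isLmodule.Build K quotient_space
  qscaleA qscale1 qscaleDr qscaleDl.

Lemma qproj_linear : linear qproj.
Proof. by move=> a u v; rewrite qprojD qprojZ. Qed.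

End QuotientSpace.

Section Tensor.
Context {K : fieldType} (V W : lmodType K).

Local Notation gen v w := << (v, w) >>.

Definition bilinear_relator : set {freeg (V * W)%type / K} :=
  [set x | (exists a v v' w,
             x = gen (a *: v + v') w - (a *: gen v w + gen v' w))
        \/ (exists a v w w',
             x = gen v (a *: w + w') - (a *: gen v w + gen v w'))].

Definition tensor := quotient_space (lspan bilinear_relator).
HB.instance Definition _ := GRing.Lmodule.on tensor.

Definition tens (v : V) (w : W) : tensor := qproj _ (gen v w).

End Tensor.

(* V ⊗ W is the space, v ⊠ w the pure tensor. *)
Notation "V ⊗ W" := (tensor V W) (at level 40, left associativity).
Notation "v ⊠ w" := (tens v w) (at level 40, left associativity).

Section TensorTheory.
Context {K : fieldType} {V W : lmodType K}.

Lemma tens_bilinear : bilinear_for *:%R *:%R (@tens K V W).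
Proof.
split=> [w a v v'|v a w w']; rewrite /tens -qproj_linear; apply/qprojP.
- apply/span_predP => U; apply; left.
  by exists a, v, v', w.
- apply/span_predP => U; apply; right.
  by exists a, v, w, w'.
Qed.

Lemma tens_ind (P : V ⊗ W -> Prop) :
    (forall v w, P (v ⊠ w)) -> (forall a x y, P x -> P y -> P (a *: x + y)) ->
  forall x, P x.
Proof.
move=> Pt PD x; rewrite -[x]qreprK; move: (qrepr x) => {}x.
have P0 : P 0.
  by have := PD (-1) _ _ (Pt 0 0) (Pt 0 0); rewrite scaleN1r addNr.
have PS I (r : seq I) (a : I -> K) (t : I -> V ⊗ W) :
    (forall i, P (t i)) -> P (\sum_(i <- r) a i *: t i).
  by move=> Pti; elim: r => [|i r IHr]; rewrite ?big_nil // big_cons; apply: PD.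
pose q := qproj (lspan (@bilinear_relator K V W)).
pose aq := GRing.isLinear.Build K _ _ *:%R q (qproj_linear _).
pose lq : {linear _ -> _} := HB.pack q aq.
rewrite -[x]freeg_sumE -[qproj _ _]/(lq _) linear_sum /=.
rewrite (eq_bigr (fun i => coeff i x *: (i.1 ⊠ i.2))) => [|[v w] _]; last first.
  have -> : << (coeff (v, w) x) *g (v, w) >> =
            coeff (v, w) x *: << (v, w) >> :> {freeg (V * W)%type / K}.
    apply/eqP/freeg_eqP => y.
    by rewrite coeffZ !coeffU mul1r.
  by rewrite -[LHS]/(lq _) linearZ.
exact: PS.
Qed.

Section Lift.
Context {Z : lmodType K} (f : V -> W -> Z).

Definition tlift_fun (x : V ⊗ W) : Z :=
  fglift (fun vw : V * W => f vw.1 vw.2) (qrepr x).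

Hypothesis f_bilin : bilinear_for *:%R *:%R f.

Let g := fglift (R := K) (fun vw : V * W => f vw.1 vw.2).

Let gB x y : g (x - y) = g x - g y.
Proof. exact: lift_is_additive. Qed.

Let g_linear : linear g.
Proof.
have g0 : g 0 = 0 by rewrite -(subrr 0) gB subrr.
have gN x : g (- x) = - g x by rewrite -sub0r gB g0 sub0r.
have gD x y : g (x + y) = g x + g y by rewrite -[y in LHS]opprK gB gN opprK.
move=> a x y; rewrite gD; congr (_ + _).
rewrite -[in RHS](freeg_sumE x) [in LHS]/GRing.scale /= /fgscale.
have gS (h : V * W -> {freeg (V * W)%type / K}) (r : seq (V * W)) :
    g (\sum_(i <- r) h i) = \sum_(i <- r) g (h i).
  by elim: r => [|i r IHr]; rewrite ?big_nil // !big_cons gD IHr.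
rewrite !gS scaler_sumr; apply: eq_bigr => i _.
by rewrite /g !liftU scalerA.
Qed.

Let g_ker x : x \in lspan (@bilinear_relator K V W) -> g x = 0.
Proof.
pose kp : {pred {freeg (V * W)%type / K}} := [pred x | g x == 0].
have kpP : submod_closed kp.
  split=> [|a u v]; rewrite !inE; first by rewrite -(subrr 0) gB subrr.
  by move=> /eqP hu /eqP hv; rewrite g_linear hu hv scaler0 addr0.
move=> /span_predP /(_ (Subspace kpP)) h; apply/eqP/h => {x h} x.
move=> hx; rewrite inE; apply/eqP.
case: hx => -[a [v [w [w' ->]]]]; rewrite gB g_linear /g !liftU !scale1r /=.
- by rewrite (f_bilin.1 w') subrr.
- by rewrite (f_bilin.2 v) subrr.
Qed.

Lemma tlift_linear : linear tlift_fun.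
Proof.
have h x : tlift_fun (qproj _ x) = g x.
  apply/eqP; rewrite -subr_eq0 -gB; apply/eqP/g_ker/qprojP.
  by rewrite qreprK.
move=> a x y; rewrite -[x]qreprK -[y]qreprK -qproj_linear !h.
exact: g_linear.
Qed.

HB.instance Definition _ :=
  GRing.isLinear.Build K (tensor V W) Z *:%R tlift_fun tlift_linear.

Definition tlift : {linear V ⊗ W -> Z} := tlift_fun.

Lemma tliftE v w : tlift (v ⊠ w) = f v w.
Proof.
have -> : f v w = g << (v, w) >> by rewrite /g liftU scale1r.
rewrite /= /tlift_fun; apply/eqP; rewrite -subr_eq0 -gB; apply/eqP/g_ker/qprojP.
by rewrite qreprK.
Qed.

End Lift.
End TensorTheory.

Section TensorMaps.
Context {K : fieldType}.
Implicit Types U V W : lmodType K.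

Lemma tmap_bilin V W V' W' (f : {linear V -> V'}) (g : {linear W -> W'}) :
  bilinear_for *:%R *:%R (fun v w => f v ⊠ g w).
Proof.
by split=> [w a v v'|v a w w']; rewrite linearP;
  [rewrite (tens_bilinear.1 (g w))|rewrite (tens_bilinear.2 (f v))].
Qed.

Definition tmap V W V' W' (f : {linear V -> V'}) (g : {linear W -> W'}) :
  {linear V ⊗ W -> V' ⊗ W'} := tlift (tmap_bilin f g).

Lemma tswap_bilin V W : bilinear_for *:%R *:%R (fun (v : V) (w : W) => w ⊠ v).
Proof.
by split=> [w a v v'|v a w w'];
  [rewrite (tens_bilinear.2 w)|rewrite (tens_bilinear.1 v)].
Qed.

Definition tswap V W : {linear V ⊗ W -> W ⊗ V} := tlift (@tswap_bilin V W).

Lemma tassoc_bilin1 U V W (u : U) :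
  bilinear_for *:%R *:%R (fun (v : V) (w : W) => u ⊠ v ⊠ w).
Proof.
split=> [w a v v'|v a w w'].
- by rewrite (tens_bilinear.2 u) (tens_bilinear.1 w).
- by rewrite (tens_bilinear.2 (u ⊠ v)).
Qed.

Lemma tassoc_bilin U V W :
  bilinear_for *:%R *:%R
    (fun (u : U) (x : V ⊗ W) => tlift (tassoc_bilin1 V W u) x).
Proof.
split=> [x a u u'|u a x y]; last by rewrite linearP.
move: x; apply: tens_ind => [v w|b x y IHx IHy].
- by rewrite !tliftE (tens_bilinear.1 v) (tens_bilinear.1 w).
- rewrite !linearP IHx IHy scalerDr scalerA (mulrC b a).
  by rewrite /= scalerDr scalerA addrACA.
Qed.

Definition tassoc U V W : {linear U ⊗ (V ⊗ W) -> U ⊗ V ⊗ W} :=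
  tlift (@tassoc_bilin U V W).

Lemma scale_bilin W : bilinear_for *:%R *:%R (fun (a : K^o) (w : W) => a *: w).
Proof.
split=> [w a v v'|v a w w'].
- by rewrite /= scalerDl; congr (_ + _); rewrite scalerA.
- by rewrite /= scalerDr !scalerA mulrC.
Qed.

Lemma scale_bilin_swap W :
  bilinear_for *:%R *:%R (fun (w : W) (a : K^o) => a *: w).
Proof. by split; [exact: (@scale_bilin W).2|exact: (@scale_bilin W).1]. Qed.

(* the identifications K ⊗ W = W and W ⊗ K = W *)
Definition tunitl W : {linear K^o ⊗ W -> W} := tlift (@scale_bilin W).
Definition tunitr W : {linear W ⊗ K^o -> W} := tlift (@scale_bilin_swap W).

End TensorMaps.

Arguments tswap {K} V W.
Arguments tassoc {K} U V W.
Arguments tunitl {K} W.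
Arguments tunitr {K} W.

Section Grading.
Context {K : fieldType} (I : choiceType) (W : lmodType K).

Definition is_decomposition (A : I -> subspace W) (w : W) (f : I -> W) : Prop :=
  [/\ finite_set [set i | f i != 0], forall i, f i \in A i
    & w = \sum_(i \in [set: I]) f i].

Definition direct_sum (A : I -> subspace W) : Prop :=
  forall w, exists! f : I -> W, is_decomposition A w f.

Record grading := Grading {
  piece :> I -> subspace W;
  piece_direct_sum : direct_sum piece }.

Variable A : grading.

Definition gproj_fun (i : I) (w : W) : W :=
  projT1 (cid (piece_direct_sum A w)) i.

Lemma gprojP w : is_decomposition A w (gproj_fun^~ w).
Proof.
by rewrite /gproj_fun; case: (cid _) => f [].
Qed.

Lemma gproj_uniq w f : is_decomposition A w f -> gproj_fun^~ w = f.
Proof.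
by move=> hf; rewrite /gproj_fun; case: (cid _) => g [_ /= /(_ _ hf)].
Qed.

Lemma gproj_linear i : linear (gproj_fun i).
Proof.
move=> a u v.
have [fu Au su] := gprojP u; have [fv Av sv] := gprojP v.
pose f i := a *: gproj_fun i u + gproj_fun i v.
suff : is_decomposition A (a *: u + v) f.
  by move=> /gproj_uniq /(congr1 (fun g => g i)).
have sub0 : [set i | f i != 0] `<=`
    [set i | gproj_fun i u != 0] `|` [set i | gproj_fun i v != 0].
  move=> j /=; have [hu|hu] := eqVneq (gproj_fun j u) 0; last by left.
  by rewrite /f hu scaler0 add0r; right.
have fin : finite_set ([set i | gproj_fun i u != 0] `|`
    [set i | gproj_fun i v != 0]) by rewrite finite_setU.
split; first exact: sub_finite_set fin.
  by move=> j; rewrite rpredD ?rpredZ.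
pose X : {fset I} := fset_set ([set i | gproj_fun i u != 0] `|`
    [set i | gproj_fun i v != 0]).
have E (h : I -> W) : (forall j, h j != 0 ->
    gproj_fun j u != 0 \/ gproj_fun j v != 0) ->
    \sum_(j \in [set: I]) h j = \sum_(j <- X) h j.
  move=> hh; rewrite (fsbigTE X) // => j.
  rewrite /X in_fset_set // => /negP jX; apply/eqP/negP => /negP hj.
  by apply: jX; apply/mem_set; exact: hh.
rewrite [in LHS]su [in LHS]sv !E.
- by rewrite scaler_sumr -big_split.
- by move=> j; exact: (sub0 j).
- by move=> j; right.
- by move=> j; left.
Qed.

HB.instance Definition _ i :=
  GRing.isLinear.Build K W W *:%R (gproj_fun i) (gproj_linear i).

Definition gproj (i : I) : {linear W -> W} := gproj_fun i.

End Grading.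

Section Series.
Context {K : fieldType}.

(* A formal series in one variable z is the function sending n to the
   coefficient of z^n; similarly for series in three variables z0, z1, z2. *)
Definition ser (T : Type) := int -> T.
Definition ser3 (T : Type) := int -> int -> int -> T.

Definition binz (n : int) (i : nat) : K :=
  (\prod_(j < i) (n%:~R - j%:R)) / (i`!)%:R.

(* coefficient of x^p y^q in the expansion of (x + y)^n in nonnegative powers
   of y *)
Definition binexp (n p q : int) : K :=
  if q is Posz i then (if p == n - q then binz n i else 0) else 0.

(* the same for (x - y)^n *)
Definition binexpN (n p q : int) : K := (-1) ^ q * binexp n p q.

(* z0^{-1} delta((z1 - z2) / z0), z0^{-1} delta((z2 - z1) / (- z0)) and
   z1^{-1} delta((z2 + z0) / z1); the term of index n of the sum defining delta
   contributes in degree - n - 1 in z0 (resp. z1) *)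
Definition delta_z1_sub_z2 : ser3 K := fun a b c => binexpN (- a - 1) b c.
Definition delta_z2_sub_z1 : ser3 K := fun a b c =>
  (-1) ^ (- a - 1) * binexpN (- a - 1) c b.
Definition delta_z2_add_z0 : ser3 K := fun a b c => binexp (- b - 1) c a.

(* The convolution product; \sum_(_ \in _) is the sum over the support, which
   has to be finite (it is in all the uses below, by truncation). *)
Definition mul3 (W : lmodType K) (f : ser3 K) (A : ser3 W) : ser3 W :=
  fun a b c => \sum_(p \in [set: int * int * int])
    f p.1.1 p.1.2 p.2 *: A (a - p.1.1) (b - p.1.2) (c - p.2).

Definition deriv_ser (W : lmodType K) (f : ser W) : ser W :=
  fun n => (n + 1)%:~R *: f (n + 1).

(* the coefficient of z^{-1} in the product of f and A, again a finite sum in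
   all the uses below *)
Definition res_mul (W : lmodType K) (f : ser K) (A : ser W) : W :=
  \sum_(n \in [set: int]) f n *: A (- 1 - n).

(* z^e (1 + z)^s and z^e z^s as series in z *)
Definition zpow_1addz (e s : int) : ser K := fun n =>
  if n - e is Posz i then binz s i else 0.
Definition zpow_z (e s : int) : ser K := fun n => (n == e + s)%:R.

End Series.

Section Structures.
Context {K : fieldType}.

(* A linear map Y(z) = \sum_k Delta_k z^{-k-1} from M to V ⊗ M[[z,z^{-1}]] is
   given by the linear maps Delta_k; [coefz Y n] is its coefficient of z^n. *)
Definition vertex_map (V M : lmodType K) := int -> {linear M -> V ⊗ M}.

Definition coefz (V M : lmodType K) (Y : vertex_map V M) :
  ser {linear M -> V ⊗ M} := fun n => Y (- n - 1).

Definition truncated (V M : lmodType K) (Y : vertex_map V M) : Prop :=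
  forall m, exists N : int, forall k, k < N -> Y k m = 0.

Definition left_counit (V M : lmodType K) (c : {linear V -> K^o})
    (Y : vertex_map V M) : Prop :=
  forall m n, tunitl M (tmap c idfun (coefz Y n m)) = if n == 0 then m else 0.

Definition jacobi (V M : lmodType K) (YV : vertex_map V V)
    (YM : vertex_map V M) : Prop :=
  forall m a b c,
    mul3 delta_z1_sub_z2
      (fun a b c => if a == 0 then
         tassoc V V M (tmap idfun (coefz YM c) (coefz YM b m)) else 0) a b c
  - mul3 delta_z2_sub_z1
      (fun a b c => if a == 0 then
         tmap (tswap V V) idfun
           (tassoc V V M (tmap idfun (coefz YM b) (coefz YM c m))) else 0) a b c
  = mul3 delta_z2_add_z0
      (fun a b c => if b == 0 then
         tmap (coefz YV a) idfun (coefz YM c m) else 0) a b c.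

Record is_vertex_coalgebra (V : lmodType K) (Y : vertex_map V V)
    (c : {linear V -> K^o}) : Prop := {
  vc_truncated : truncated Y;
  vc_left_counit : left_counit c Y;
  vc_right_counit_regular : forall v n, n < 0 ->
    tunitr V (tmap idfun c (coefz Y n v)) = 0;
  vc_right_counit_limit : forall v,
    tunitr V (tmap idfun c (coefz Y 0 v)) = v;
  vc_jacobi : jacobi Y Y }.

(* (V ⊗ M)_t, the sum over s of the V_{t-s} ⊗ M_s, where M is graded by J and
   [wt] embeds J in the integers *)
Definition tensor_piece (V M : lmodType K) (J : Type) (wt : J -> int)
    (gV : int -> subspace V) (gM : J -> subspace M) (t : int) :
    subspace (V ⊗ M) :=
  lspan [set x | exists s v m,
    [/\ v \in gV (t - wt s), m \in gM s & x = v ⊠ m]].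

(* the maps L(k) defined by (rho ⊗ Id) Y(z) = \sum_k L(k) z^{k-2} *)
Definition Lop (V M : lmodType K) (rho : {linear V -> K^o})
    (Y : vertex_map V M) (k : int) : {linear M -> M} :=
  tunitl M \o tmap rho idfun \o coefz Y (k - 2).

Definition virasoro (M : lmodType K) (L : int -> M -> M) (d : K) : Prop :=
  forall k j m,
    L k (L j m) - L j (L k m) =
      (k - j)%:~R *: L (k + j) m
      + (if k + j == 0 then (k ^+ 3 - k)%:~R / 12%:R * d else 0) *: m.

(* The eigenvalue condition makes the grading unique. *)
Record graded_voc := GradedVOC {
  voc_sort :> lmodType K;
  voc_Y : vertex_map voc_sort voc_sort;
  voc_c : {linear voc_sort -> K^o};
  voc_rho : {linear voc_sort -> K^o};
  voc_rank : K;
  voc_gr : grading int voc_sort;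
  voc_vertex_coalgebra : is_vertex_coalgebra voc_Y voc_c;
  voc_fin_dim : forall s, fin_dim (voc_gr s);
  voc_bounded_below : exists N : int, forall s, s < N ->
    forall v, v \in voc_gr s -> v = 0;
  voc_graded : forall k s v, v \in voc_gr s ->
    voc_Y k v \in tensor_piece id voc_gr voc_gr (s + k + 1);
  voc_virasoro : virasoro (Lop voc_rho voc_Y) voc_rank;
  voc_eigenspace : forall s v,
    (v \in voc_gr s) <-> (Lop voc_rho voc_Y 0 v = s%:~R *: v);
  voc_L1 : forall v n,
    tmap (Lop voc_rho voc_Y 1) idfun (coefz voc_Y n v)
    = deriv_ser (fun n => coefz voc_Y n v) n }.

Record weak_comodule (V : graded_voc) := WeakComodule {
  com_space :> lmodType K;
  com_Y : vertex_map V com_space;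
  com_truncated : truncated com_Y;
  com_left_counit : left_counit (voc_c V) com_Y;
  com_jacobi : jacobi (voc_Y V) com_Y;
  com_virasoro : virasoro (Lop (voc_rho V) com_Y) (voc_rank V);
  com_L1 : forall m n,
    tmap (Lop (voc_rho V) (voc_Y V) 1) idfun (coefz com_Y n m)
    = deriv_ser (fun n => coefz com_Y n m) n;
  com_L1_comm : forall m n,
    deriv_ser (fun n => coefz com_Y n m) n
    = coefz com_Y n (Lop (voc_rho V) com_Y 1 m)
      - tmap idfun (Lop (voc_rho V) com_Y 1) (coefz com_Y n m) }.

Record admissible_comodule (V : graded_voc) := AdmissibleComodule {
  adm_weak :> weak_comodule V;
  adm_gr : grading nat adm_weak;
  adm_graded : forall k t m, m \in adm_gr t ->
    com_Y adm_weak k m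
      \in tensor_piece Posz (voc_gr V) adm_gr (Posz t + k + 1) }.

Definition is_comodule_hom (V : graded_voc) (M1 M2 : weak_comodule V)
    (psi : {linear M1 -> M2}) : Prop :=
  forall n m, tmap idfun psi (coefz (com_Y M1) n m)
              = coefz (com_Y M2) n (psi m).

(* Res_z (phi(z)^{L(0)} z^e ⊗ Id) Y(z) m, given by its components in the
   V_s ⊗ M_t; [phi s] is the series by which phi(z)^{L(0)} z^e acts on V_s. *)
Definition res_L0 (V M : lmodType K) (J : choiceType) (gV : grading int V)
    (gM : grading J M) (phi : int -> ser K) (Y : vertex_map V M) (m : M) :
    int -> J -> V ⊗ M :=
  fun s t => res_mul (phi s)
    (fun n => tmap (gproj gV s) (gproj gM t) (coefz Y n m)).

Definition components (V M : lmodType K) (J : choiceType) (gV : grading int V)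
    (gM : grading J M) (x : V ⊗ M) : int -> J -> V ⊗ M :=
  fun s t => tmap (gproj gV s) (gproj gM t) x.

Definition C_space (V : graded_voc) : subspace V :=
  lspan [set v | forall s t,
    res_L0 (voc_gr V) (voc_gr V) (zpow_1addz (- 2)) (voc_Y V) v s t = 0].

Notation C_sort V := (subspace_sort (C_space V)).

Definition C_delta (V : graded_voc) : V -> int -> int -> V ⊗ V :=
  res_L0 (voc_gr V) (voc_gr V) (zpow_1addz (- 1)) (voc_Y V).

Notation M0_sort M := (subspace_sort (adm_gr M 0%N)).

Definition M0_delta (V : graded_voc) (M : admissible_comodule V) :
    M -> int -> nat -> V ⊗ M :=
  res_L0 (voc_gr V) (adm_gr M) (zpow_z (- 1)) (com_Y M).

Record coalgebra (A : lmodType K) := Coalgebra {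
  comult : {linear A -> A ⊗ A};
  counit : {linear A -> K^o};
  coassoc : forall x,
    tassoc A A A (tmap idfun comult (comult x)) = tmap comult idfun (comult x);
  counitl : forall x, tunitl A (tmap counit idfun (comult x)) = x;
  counitr : forall x, tunitr A (tmap idfun counit (comult x)) = x }.

Record coaction (A : lmodType K) (cA : coalgebra A) (N : lmodType K) :=
  Coaction {
  coact :> {linear N -> A ⊗ N};
  coact_coassoc : forall x,
    tassoc A A N (tmap idfun coact (coact x))
    = tmap (comult cA) idfun (coact x);
  coact_counit : forall x, tunitl N (tmap (counit cA) idfun (coact x)) = x }.

(* "C(V) is a coassociative coalgebra with comultiplication [C_delta] and
   counit c|_{C(V)}": an inhabitant, which is unique when there is one, consists
   of a comultiplication with values in C(V) ⊗ C(V) inducing [C_delta], and of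
   the axioms. *)
Record C_coalgebra (V : graded_voc) := CCoalgebra {
  C_str :> coalgebra (C_sort V);
  C_comultE : forall v,
    components (voc_gr V) (voc_gr V) (tmap (incl _) (incl _) (comult C_str v))
    = C_delta (val v);
  C_counitE : forall v, counit C_str v = voc_c V (val v) }.

(* "M_0 is a left C(V)-comodule via [M0_delta]", in the same sense *)
Record M0_comodule (V : graded_voc) (CV : C_coalgebra V)
    (M : admissible_comodule V) := M0Comodule {
  M0_str :> coaction CV (M0_sort M);
  M0_coactE : forall m,
    components (voc_gr V) (adm_gr M) (tmap (incl _) (incl _) (M0_str m))
    = M0_delta (val m) }.

Definition is_coaction_hom (A : lmodType K) (cA : coalgebra A)
    (N1 N2 : lmodType K) (d1 : coaction cA N1) (d2 : coaction cA N2)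
    (phi : {linear N1 -> N2}) : Prop :=
  forall x, tmap idfun phi (d1 x) = d2 (phi x).

End Structures.

Notation C_sort V := (subspace_sort (C_space V)).
Notation M0_sort M := (subspace_sort (adm_gr M 0%N)).

Record category := Category {
  Ob :> Type;
  Hom : Ob -> Ob -> Type;
  idm : forall X, Hom X X;
  compm : forall X Y Z, Hom Y Z -> Hom X Y -> Hom X Z;
  compmA : forall W X Y Z (h : Hom Y Z) (g : Hom X Y) (f : Hom W X),
    compm h (compm g f) = compm (compm h g) f;
  comp1m : forall X Y (f : Hom X Y), compm (idm Y) f = f;
  compm1 : forall X Y (f : Hom X Y), compm f (idm X) = f }.

Record functor_on (C D : category) (F : C -> D) := FunctorOn {
  fmap : forall X Y : C, Hom X Y -> Hom (F X) (F Y);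
  fmap_id : forall X, fmap (idm X) = idm (F X);
  fmap_comp : forall X Y Z (g : Hom Y Z) (f : Hom X Y),
    fmap (compm g f) = compm (fmap g) (fmap f) }.

Lemma linear_ext (K : fieldType) (V W : lmodType K) (f g : {linear V -> W}) :
  f =1 g -> f = g.
Proof.
move=> /funext; case: f => f hf; case: g => g hg /= E; subst g.
congr GRing.Linear.Pack; case: hf hg => [[a] [b]] [[a'] [b']].
by rewrite (Prop_irrelevance a a') (Prop_irrelevance b b').
Qed.

Lemma tmap_id (K : fieldType) (V W : lmodType K) x :
  tmap (idfun : {linear V -> V}) (idfun : {linear W -> W}) x = x.
Proof.
move: x; apply: tens_ind => [v w|a x y IHx IHy]; first by rewrite tliftE.
by rewrite linearP IHx IHy.
Qed.

Lemma tmap_comp (K : fieldType) (V W W' W'' : lmodType K)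
    (f : {linear W' -> W''}) (g : {linear W -> W'}) x :
  tmap (idfun : {linear V -> V}) (f \o g) x = tmap idfun f (tmap idfun g x).
Proof.
move: x; apply: tens_ind => [v w|a x y IHx IHy]; first by rewrite !tliftE.
by rewrite !linearP IHx IHy.
Qed.

Section AdmissibleCategory.
Context {K : fieldType} (V : @graded_voc K).
Implicit Types M : admissible_comodule V.

(* Comodule homomorphisms are not required to respect the gradings, and the
   inclusion psi(M1_0) ⊆ M2_0 needed for psi|_{M1_0} : M1_0 -> M2_0 to make
   sense is not automatic (shift the grading of a comodule by one). *)
Record adm_hom M1 M2 := AdmHom {
  adm_map :> {linear M1 -> M2};
  adm_map_comodule_hom : is_comodule_hom adm_map;
  adm_map_M0 : forall m, m \in adm_gr M1 0%N -> adm_map m \in adm_gr M2 0%N }.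

Lemma adm_hom_ext M1 M2 (f g : adm_hom M1 M2) : f =1 g -> f = g.
Proof.
case: f g => f f1 f2 [g g1 g2] /= /linear_ext E; subst g.
by rewrite (Prop_irrelevance f1 g1) (Prop_irrelevance f2 g2).
Qed.

Definition adm_id M : adm_hom M M.
Proof.
exists (idfun : {linear M -> M}) => [n m|m //].
exact: tmap_id.
Defined.

Definition adm_comp M1 M2 M3 (g : adm_hom M2 M3) (f : adm_hom M1 M2) :
  adm_hom M1 M3.
Proof.
exists ((adm_map g \o adm_map f) : {linear M1 -> M3}) => [n m|m hm].
- by rewrite tmap_comp !adm_map_comodule_hom.
- by do 2!apply: adm_map_M0.
Defined.

Definition admissible_category : category.
Proof.
by refine (@Category (admissible_comodule V) adm_hom adm_id adm_comp _ _ _);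
  move=> *; apply: adm_hom_ext.
Defined.

Definition M0_restrict M1 M2 (f : adm_hom M1 M2) :
  {linear M0_sort M1 -> M0_sort M2} := restrict (@adm_map_M0 _ _ f).

End AdmissibleCategory.

Section ComoduleCategory.
Context {K : fieldType} {A : lmodType K} (cA : coalgebra A).

Record comodule := Comodule {
  com_sort :> lmodType K;
  com_coact : coaction cA com_sort }.

Record com_hom (N1 N2 : comodule) := ComHom {
  com_map :> {linear N1 -> N2};
  com_map_coact : is_coaction_hom (com_coact N1) (com_coact N2) com_map }.

Lemma com_hom_ext N1 N2 (f g : com_hom N1 N2) : f =1 g -> f = g.
Proof.
case: f g => f f1 [g g1] /= /linear_ext E; subst g.
by rewrite (Prop_irrelevance f1 g1).
Qed.

Definition com_id N : com_hom N N.
Proof.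
exists (idfun : {linear N -> N}) => x.
exact: tmap_id.
Defined.

Definition com_comp N1 N2 N3 (g : com_hom N2 N3) (f : com_hom N1 N2) :
  com_hom N1 N3.
Proof.
exists ((com_map g \o com_map f) : {linear N1 -> N3}) => x.
by rewrite tmap_comp !com_map_coact.
Defined.

Definition comodule_category : category.
Proof.
by refine (@Category comodule com_hom com_id com_comp _ _ _);
  move=> *; apply: com_hom_ext.
Defined.

End ComoduleCategory.

Definition Omega_ob (K : fieldType) (V : @graded_voc K) (CV : C_coalgebra V)
    (com : forall M : admissible_comodule V, M0_comodule CV M) :
    admissible_category V -> comodule_category CV :=
  fun M => Comodule (com M : coaction CV (M0_sort M)).

(* Main.v *)
Require Import Defs.
From HB Require Import structures.
From mathcomp Require Import all_boot all_order all_algebra.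
From mathcomp Require Import boolp classical_sets cardinality fsbigop finmap.
From mathcomp Require Import reals complex.

Set Implicit Arguments.
Unset Strict Implicit.
Unset Printing Implicit Defensive.

Import GRing.Theory.
Local Open Scope ring_scope.

(** Write P_s and P_t for the projections of V and M onto their homogeneous
    pieces. The factor z^{L(0)-1} selects a single coefficient in each
    bidegree: the component of the formal coaction of M_0 in V_s ⊗ M_t is
    (P_s ⊗ P_t) Δ_{s-1}(m) ([M0_deltaE]).

    The homomorphism ψ commutes with every Δ_k, but it need not respect the
    gradings beyond ψ(M1_0) ⊆ M2_0, so its commutation with P_s ⊗ P_t has to
    come from the degree: Δ_{s-1}(m) lies in ⊕_j V_{s-j} ⊗ M_j, and P_s kills
    every summand except V_s ⊗ M_0. On M_0 the map ψ does commute with P_t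
    ([gproj_hom_piece]), whence the first claim ([M0_delta_hom]).

    An actual coaction M_0 -> C(V) ⊗ M_0 is determined by its components in
    V ⊗ M. Indeed C(V) ⊗ M_0 -> V ⊗ M is injective, because every subspace of
    a vector space is a retract ([tmap_incl_inj]), and an element of V ⊗ M is
    the finite sum of its components ([components_inj]). Both sides of the
    comodule homomorphism equation have the same components by the first claim,
    which gives the second ([M0_restrict_coaction_hom]). Functoriality is then
    immediate, since restriction is compatible with identities and
    composition. *)

(** * Linear maps on spans and tensor products *)

Section LinearExtension.
Context {K : fieldType}.
Implicit Types U V W Z : lmodType K.

Lemma lspan_ext W Z (S : set W) (f g : {linear W -> Z}) :
  (forall w, S w -> f w = g w) -> forall w, w \in lspan S -> f w = g w.
Proof.
move=> fg.
pose E : {pred W} := [pred w | f w == g w].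
have E_closed : submod_closed E.
  split=> [|a u v]; first by rewrite inE !linear0.
  by rewrite !inE => /eqP fu /eqP fv; rewrite !linearP fu fv.
move=> w /span_predP /(_ (Subspace E_closed)) wE; apply/eqP/wE => s Ss.
by rewrite inE fg.
Qed.

Lemma tens_ext V W Z (f g : {linear V ⊗ W -> Z}) :
  (forall v w, f (v ⊠ w) = g (v ⊠ w)) -> f =1 g.
Proof.
by move=> fg; apply: tens_ind => [|a x y fx fy]; rewrite ?linearP ?fx ?fy.
Qed.

Lemma tens0l V W (w : W) : (0 : V) ⊠ w = 0.
Proof.
have := (@tens_bilinear K V W).1 w (-1) 0 0.
by rewrite /= scaler0 addr0 scaleN1r addNr.
Qed.

Lemma tmapE V W V' W' (f : {linear V -> V'}) (g : {linear W -> W'}) v w :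
  tmap f g (v ⊠ w) = f v ⊠ g w.
Proof. exact: tliftE. Qed.

Lemma tmap_can V W V' W' (f : {linear V -> V'}) (g : {linear W -> W'})
    (f' : {linear V' -> V}) (g' : {linear W' -> W}) :
  cancel f f' -> cancel g g' -> cancel (tmap f g) (tmap f' g').
Proof.
move=> ff' gg'; apply: tens_ind => [v w|a x y IHx IHy].
  by rewrite !tmapE ff' gg'.
by rewrite !linearP IHx IHy.
Qed.

End LinearExtension.

(** * Subspaces are retracts *)

Section Retraction.
Context {K : fieldType} {W : lmodType K} (U : subspace W).

(** A subset maximal among those closed under linear combinations and meeting
    U only in 0 is a complement: if v were not in the sum, adjoining v to it
    would contradict maximality. The conditions hold for the empty set, as
    Zorn's lemma needs for the empty chain. *)
Lemma complement_exists : exists C : subspace W,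
  (forall w, w \in U -> w \in C -> w = 0)
  /\ (forall w, exists2 u, u \in U & w - u \in C).
Proof.
pose P (A : set W) := (forall a u v, A u -> A v -> A (a *: u + v))
  /\ (forall u, A u -> u \in U -> u = 0).
have [F FP Ftot|A [[Alin AU] Amax]] := @Zorn_bigcup W P.
  split=> [a u v [X FX Xu] [Y FY Yv]|u [X FX Xu]]; last exact: (FP X FX).2.
  have [XY|YX] := Ftot _ _ FX FY.
  - by exists Y => //; apply: (FP Y FY).1 => //; exact: XY.
  - by exists X => //; apply: (FP X FX).1 => //; exact: YX.
have A0 : A 0.
  have [a Aa] : exists a, A a.
    apply: contrapT => Anone; apply: (Amax [set 0]%classic).
      split=> [a Aa|/(_ 0 erefl) A0]; last by apply: Anone; exists 0.
      by case: Anone; exists a.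
    by split=> [a u v -> ->|u -> //]; rewrite /= scaler0 addr0.
  by rewrite -(addNr a) -scaleN1r; exact: Alin.
pose Ab : {pred W} := [pred w | `[< A w >]].
have Ab_closed : submod_closed Ab.
  split=> [|a u v]; first exact/asboolP.
  by move=> /asboolP Au /asboolP Av; apply/asboolP; exact: Alin.
exists (Subspace Ab_closed); split=> [w wU /asboolP Aw|v]; first exact: AU.
apply: contrapT => vUA.
pose B : set W := [set x | exists k a, A a /\ x = k *: v + a]%classic.
apply: (Amax B).
  split=> [a Aa|BA]; first by exists 0, a; rewrite scale0r add0r.
  apply: vUA; exists 0; rewrite ?rpred0 // subr0; apply/asboolP/BA.
  by exists 1, 0; rewrite scale1r addr0.
split=> [k _ _ [i [a [Aa ->]]] [j [b [Ab' ->]]]|_ [k [a [Aa ->]]] kvaU].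
  exists (k * i + j), (k *: a + b); split; first exact: Alin.
  by rewrite scalerDr scalerA scalerDl addrACA.
have [k0|k0] := eqVneq k 0.
  by move: kvaU; rewrite k0 scale0r add0r; exact: AU.
case: vUA; exists (k^-1 *: (k *: v + a)); first exact: rpredZ.
rewrite scalerDr scalerA mulVf // scale1r opprD addrA subrr add0r -scalerN.
by apply/asboolP; rewrite -scaleN1r scalerA -[X in A X]addr0; exact: Alin.
Qed.

(** The projection onto U along a complement: the U-component of w is unique,
    hence linear in w. *)
Lemma retraction_exists :
  exists r : {linear W -> subspace_sort U}, cancel (incl U) r.
Proof.
have [C [UC0 UC]] := complement_exists.
have rP w : {u : subspace_sort U | w - val u \in C}.
  by apply: cid; have [u uU wuC] := UC w; exists (exist _ u uU).
have r_uniq w (u : subspace_sort U) : w - val u \in C -> sval (rP w) = u.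
  move=> wuC; apply: val_inj; apply/eqP; rewrite -subr_eq0; apply/eqP.
  apply: UC0; first exact: rpredB (valP _) (valP _).
  have -> : val (sval (rP w)) - val u = (w - val u) - (w - val (sval (rP w))).
    by rewrite opprB [RHS]addrC addrA subrK.
  by rewrite rpredB // (svalP (rP w)).
have r_linear : linear (fun w => sval (rP w)).
  move=> a u v; apply: r_uniq; rewrite -[val _]/(incl U _) linearP addrACA.
  rewrite -scalerDr.
  exact: rpredD (rpredZ a (svalP (rP u))) (svalP (rP v)).
pose r_isLinear := GRing.isLinear.Build K _ _ *:%R _ r_linear.
pose r : {linear W -> subspace_sort U} :=
  HB.pack (fun w => sval (rP w)) r_isLinear.
by exists r => u; apply: r_uniq; rewrite subrr rpred0.
Qed.

End Retraction.

Lemma tmap_incl_inj (K : fieldType) (V W : lmodType K) (A : subspace V)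
  (B : subspace W) : injective (tmap (incl A) (incl B)).
Proof.
have [r rK] := retraction_exists A; have [q qK] := retraction_exists B.
exact: can_inj (tmap_can rK qK).
Qed.

(** * Homogeneous components *)

Section Components.
Context {K : fieldType}.

Lemma gproj_piece (I : choiceType) (W : lmodType K) (A : grading I W) i j w :
  w \in A j -> gproj A i w = if i == j then w else 0.
Proof.
move=> wAj; pose f i := if i == j then w else 0.
suff /gproj_uniq /(congr1 (fun g => g i)) : is_decomposition A w f by [].
have f0 k : k \notin [fset j]%fset -> f k = 0.
  by rewrite inE /f => /negPf ->.
split=> [|k|].
- by apply: (finite_subfset [fset j]%fset) => k; apply: contraNT => /f0 ->.
- by rewrite /f; case: eqP => [->|_] //; exact: rpred0.
- by rewrite (fsbigTE [fset j]%fset) // big_seq_fset1 /f eqxx.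
Qed.

(** The sum is allowed to run over any larger finite set, so that the
    decompositions of several vectors can be indexed by a common set. *)
Lemma gproj_sum (I : choiceType) (W : lmodType K) (A : grading I W) w :
  exists X : {fset I}, forall Y : {fset I}, (X `<=` Y)%fset ->
    w = \sum_(i <- Y) gproj A i w.
Proof.
have [fin _ sum_w] := gprojP A w; exists (fset_set [set i | gproj A i w != 0]).
move=> Y /fsubsetP XY; rewrite {1}sum_w; apply: fsbigTE => i iY.
apply/eqP; apply: contraNT iY => wi; apply: XY.
by rewrite in_fset_set //; exact: mem_set.
Qed.

Section Tensor.
Context {V M : lmodType K} {J : choiceType}.
Variables (gV : grading int V) (gM : grading J M).

Lemma components_sum x : exists (X : {fset int}) (Y : {fset J}),
  forall (X' : {fset int}) (Y' : {fset J}), (X `<=` X')%fset ->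
    (Y `<=` Y')%fset ->
  x = \sum_(s <- X') \sum_(t <- Y') components gV gM x s t.
Proof.
move: x; apply: tens_ind => [v m|a x y [Xx [Yx hx]] [Xy [Yy hy]]].
  have [X hX] := gproj_sum gV v; have [Y hY] := gproj_sum gM m.
  exists X, Y => X' Y' XX' YY'.
  have tl (w : M) : linear (fun v : V => v ⊠ w).
    by move=> a u u'; rewrite (tens_bilinear.1 w).
  have tr (u : V) : linear (fun w : M => u ⊠ w).
    by move=> a w w'; rewrite (tens_bilinear.2 u).
  rewrite {1}(hX _ XX').
  pose tlL := GRing.isLinear.Build K _ _ *:%R _ (tl m).
  pose tlm : {linear V -> V ⊗ M} := HB.pack (fun v : V => v ⊠ m) tlL.
  rewrite -[LHS]/(tlm _) linear_sum; apply: eq_bigr => s _ /=.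
  pose trL := GRing.isLinear.Build K _ _ *:%R _ (tr (gproj gV s v)).
  pose trv : {linear M -> V ⊗ M} :=
    HB.pack (fun m : M => gproj gV s v ⊠ m) trL.
  rewrite {1}(hY _ YY') -[LHS]/(trv _) linear_sum; apply: eq_bigr => t _ /=.
  by rewrite /components tmapE.
exists (Xx `|` Xy)%fset, (Yx `|` Yy)%fset => X' Y'.
rewrite !fsubUset => /andP[XxX' XyX'] /andP[YxY' YyY'].
rewrite {1}(hx X' Y') // {1}(hy X' Y') // scaler_sumr -big_split.
apply: eq_bigr => s _; rewrite /= scaler_sumr -big_split.
by apply: eq_bigr => t _; rewrite /components linearP.
Qed.

Lemma components_inj x y :
  (forall s t, components gV gM x s t = components gV gM y s t) -> x = y.
Proof.
move=> xy; have [Xx [Yx hx]] := components_sum x.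
have [Xy [Yy hy]] := components_sum y.
rewrite (hx (Xx `|` Xy)%fset (Yx `|` Yy)%fset) ?fsubsetUl //.
rewrite [RHS](hy (Xx `|` Xy)%fset (Yx `|` Yy)%fset) ?fsubsetUr //.
by apply: eq_bigr => s _; apply: eq_bigr => t _.
Qed.

End Tensor.
End Components.

(** * Homomorphisms and the degree-zero piece *)

Section Homomorphism.
Context {K : fieldType} (V : @graded_voc K) (M1 M2 : admissible_comodule V).

Lemma M0_deltaE (M : admissible_comodule V) (m : M) s t :
  M0_delta m s t
  = tmap (gproj (voc_gr V) s) (gproj (adm_gr M) t) (com_Y M (s - 1) m).
Proof.
rewrite /M0_delta /res_L0 /res_mul.
rewrite (fsbigTE [fset (- 1 + s)%R]%fset) => [|n].
  rewrite big_seq_fset1 /zpow_z eqxx scale1r /coefz.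
  by rewrite opprB addrAC opprK subrK addrC.
by rewrite inE /zpow_z => /negPf ->; rewrite scale0r.
Qed.

Variable psi : adm_hom M1 M2.

Lemma gproj_hom_piece t m : m \in adm_gr M1 0%N ->
  psi (gproj (adm_gr M1) t m) = gproj (adm_gr M2) t (psi m).
Proof.
move=> m0; rewrite (gproj_piece t m0) (gproj_piece t (adm_map_M0 psi m0)).
by case: ifP; rewrite ?linear0.
Qed.

(** In bidegree (s, t) only the summand V_s ⊗ M_0 of (V ⊗ M)_s matters: the
    other summands V_{s-j} ⊗ M_j are killed by the projection on V_s, whatever
    psi does to M_j. *)
Lemma components_hom s t x :
  x \in tensor_piece Posz (voc_gr V) (adm_gr M1) s ->
  tmap idfun psi (components (voc_gr V) (adm_gr M1) x s t)
  = components (voc_gr V) (adm_gr M2) (tmap idfun psi x) s t.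
Proof.
rewrite /components.
rewrite -[LHS]/((tmap idfun psi \o tmap (gproj _ s) (gproj (adm_gr M1) t)) x).
rewrite -[RHS]/((tmap (gproj _ s) (gproj (adm_gr M2) t) \o tmap idfun psi) x).
apply: lspan_ext => {x} _ [j [v [m [vV mM ->]]]].
rewrite -[LHS]/(tmap _ _ (tmap _ _ _)) -[RHS]/(tmap _ _ (tmap _ _ _)) !tmapE /=.
rewrite -[gproj_fun _ s v]/(gproj _ s v) (gproj_piece s vV).
case: eqP => [s_eq|_]; last by rewrite !tens0l.
have j0 : j = 0%N.
  have /eqP : - Posz j = 0 by apply: (addrI s); rewrite addr0 -s_eq.
  by rewrite oppr_eq0 => /eqP [].
by rewrite gproj_hom_piece // -j0.
Qed.

Lemma M0_delta_hom (m : M1) s t : m \in adm_gr M1 0%N ->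
  tmap idfun psi (M0_delta m s t) = M0_delta (psi m) s t.
Proof.
move=> m0; rewrite !M0_deltaE.
have Y_deg := @adm_graded _ _ M1 (s - 1) 0%N m m0.
rewrite add0r subrK in Y_deg.
rewrite -[LHS]/(tmap idfun psi (components _ _ _ s t)) components_hom //.
by have := adm_map_comodule_hom psi (- s) m; rewrite /coefz opprK => ->.
Qed.

Lemma M0_restrict_coaction_hom (CV : C_coalgebra V)
    (d1 : M0_comodule CV M1) (d2 : M0_comodule CV M2) :
  is_coaction_hom d1 d2 (M0_restrict psi).
Proof.
move=> m; apply: tmap_incl_inj; apply: (@components_inj _ _ _ _ (voc_gr V)
  (adm_gr M2)) => s t.
rewrite M0_coactE -[val (M0_restrict psi m)]/(psi (val m)).
rewrite -(M0_delta_hom _ _ (valP m)) -(M0_coactE d1) /components.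
(* The second tensor factors of x lie in M_0, where psi commutes with the
   projections. *)
move: (M0_str d1 m) => x; pose p i := gproj (voc_gr V) i.
rewrite -[LHS]/((tmap (p s) (gproj (adm_gr M2) t) \o
  (tmap (incl _) (incl _) \o tmap idfun (M0_restrict psi))) x).
rewrite -[RHS]/((tmap idfun psi \o (tmap (p s) (gproj (adm_gr M1) t) \o
  tmap (incl _) (incl _))) x).
apply: tens_ext => c n.
rewrite -[LHS]/(tmap _ _ (tmap _ _ (tmap _ _ _))).
rewrite -[RHS]/(tmap _ _ (tmap _ _ (tmap _ _ _))) !tmapE.
congr (_ ⊠ _).
by rewrite -gproj_hom_piece ?(valP n).
Qed.

End Homomorphism.

(* The map psi of an [adm_hom M1 M2] is a comodule homomorphism that maps M1_0
   to M2_0. The first part says that psi intertwines the formal coactions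
   [M0_delta]; the others use the facts that C(V) is a coalgebra and M_0 a
   C(V)-comodule, through [CV], [d1], [d2] and [com]. *)
Theorem proposition4p3 (R : realType) (V : @graded_voc R[i])
    (hfin : fin_dim (C_space V)) :
  (forall (M1 M2 : admissible_comodule V) (psi : adm_hom M1 M2)
      (m : M0_sort M1) (s : int) (t : nat),
    tmap idfun psi (M0_delta (val m) s t) = M0_delta (psi (val m)) s t)
  /\
  forall CV : C_coalgebra V,
  (forall (M1 M2 : admissible_comodule V)
      (d1 : M0_comodule CV M1) (d2 : M0_comodule CV M2) (psi : adm_hom M1 M2),
    is_coaction_hom d1 d2 (M0_restrict psi))
  /\
  (forall com : forall M : admissible_comodule V, M0_comodule CV M,
    exists Omega : functor_on (Omega_ob com),
      forall (M1 M2 : admissible_comodule V) (psi : adm_hom M1 M2)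
        (m : M0_sort M1),
      com_map (fmap Omega psi : com_hom (Omega_ob com M1) (Omega_ob com M2)) m
      = M0_restrict psi m).
Proof.
split=> [M1 M2 psi m s t|CV]; first exact: M0_delta_hom (valP m).
split=> [M1 M2 d1 d2 psi|com]; first exact: M0_restrict_coaction_hom.
pose Omega_hom (M1 M2 : admissible_comodule V) (psi : adm_hom M1 M2) :
    com_hom (Omega_ob com M1) (Omega_ob com M2) :=
  @ComHom _ _ CV (Omega_ob com M1) (Omega_ob com M2) (M0_restrict psi)
    (M0_restrict_coaction_hom psi (com M1) (com M2)).
unshelve eexists.
  exists Omega_hom => [M|M1 M2 M3 g f];
    by apply: com_hom_ext => m; apply: val_inj.
by [].
Qed.
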